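(* Let $R$ be a commutative ring with unit and let $G$ be a finite group. An element $q\in R[G\times G]$ defines a quantization of the category $Mod_R(G)$ (by $Q_{X,Y}(x\otimes y)=q\cdot(x\otimes y)$ for all $G$-modules $X,Y$ and $x\in X$, $y\in Y$) if and only if the following three conditions hold: (1) Coherence: $(1\otimes\Delta)(q)\cdot(1\otimes q)=(\Delta\otimes 1)(q)\cdot(q\otimes 1)$ in $R[G\times G\times G]$. (2) Normalization: $q\cdot(x\otimes 1)=x\otimes 1$ and $q\cdot(1\otimes x)=1\otimes x$ for every $G$-module $X$ in $Mod_R(G)$ and every $x\in X$, where $1$ is the unit element of the trivial $G$-module $R$. (3) Naturality: $q\cdot\Delta(g)=\Delta(g)\cdot q$ for all $g\in G$.
   Context: $Mod_R(G)$ is the monoidal category of finitely generated $G$-modules over $R$ (equivalently, $R[G]$-modules). The tensor product $X\otimes Y$ is taken over $R$, with $G$-action $g(x\otimes y)=gx\otimes gy$; the unit object is $R$ with trivial action. The algebra $R[G\times G]=R[G]\otimes R[G]$ acts on $X\otimes Y$ by $(g,h)\cdot(x\otimes y)=gx\otimes hy$. $\Delta:R[G]\to R[G\times G]$ is the diagonal, the $R$-linear map with $\Delta(g)=(g,g)$. For $q=\sum_{g,h}q_{g,h}(g,h)$: $(1\otimes\Delta)(q)=\sum q_{g,h}(g,h,h)$, $(\Delta\otimes1)(q)=\sum q_{g,h}(g,g,h)$, $1\otimes q=\sum q_{g,h}(1,g,h)$, $q\otimes 1=\sum q_{g,h}(g,h,1)$. A quantization $Q$ of $Mod_R(G)$ is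 a family of $G$-module morphisms $Q_{X,Y}:X\otimes Y\to X\otimes Y$ (not necessarily isomorphisms), natural in $X$ and $Y$, satisfying the coherence condition $$Q_{X,Y\otimes Z}\circ(1_X\otimes Q_{Y,Z})=Q_{X\otimes Y,Z}\circ(Q_{X,Y}\otimes 1_Z)$$ for all $X,Y,Z$ (with the standard associativity identification), and normalized: $Q_{X,R}=\mathrm{id}_{X\otimes R}$ and $Q_{R,X}=\mathrm{id}_{R\otimes X}$ for all $X$. *)

(* Defs.v *)
From HB Require Import structures.
From mathcomp Require Import all_boot all_order all_algebra all_fingroup.
From mathcomp Require Import generic_quotient boolp.

Set Implicit Arguments.
Unset Strict Implicit.
Unset Printing Implicit Defensive.

Import GRing.Theory.
Local Open Scope ring_scope.
Local Open Scope quotient_scope.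

(* R[G]: an element a : galg R G is the formal sum of the (a g) g, and the
   product is convolution.  The alias hides the pointwise product that
   {ffun G -> R} may otherwise carry. *)
Definition galg (R : comPzRingType) (G : finGroupType) : Type := {ffun G -> R^o}.

HB.instance Definition _ (R : comPzRingType) (G : finGroupType) :=
  GRing.Lmodule.copy (galg R G) {ffun G -> R^o}.

Section GroupAlgebra.
Variables (R : comPzRingType) (G : finGroupType).
Implicit Types (a b c : galg R G) (g h : G).

Definition gcoef a g : R := (a : {ffun G -> R^o}) g.

Definition gelt g : galg R G := [ffun h : G => (h == g)%:R : R^o].

Definition galg_mul a b : galg R G :=
  [ffun g : G => (\sum_(h : G) gcoef a h * gcoef b (h^-1 * g)%g : R^o)].

Lemma galgP a b : (forall g, gcoef a g = gcoef b g) -> a = b.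
Proof. by move=> eq_ab; apply/ffunP. Qed.

Lemma gcoefD a b g : gcoef (a + b) g = gcoef a g + gcoef b g.
Proof. by rewrite /gcoef ffunE. Qed.

Lemma gcoefZ (r : R) a g : gcoef (r *: a) g = r * gcoef a g.
Proof. by rewrite /gcoef ffunE. Qed.

Lemma gcoef_elt g h : gcoef (gelt g) h = (h == g)%:R.
Proof. by rewrite /gcoef ffunE. Qed.

Lemma gcoef_mul a b g :
  gcoef (galg_mul a b) g = \sum_(h : G) gcoef a h * gcoef b (h^-1 * g)%g.
Proof. by rewrite /gcoef ffunE. Qed.

Lemma galg_mulA : associative galg_mul.
Proof.
move=> a b c; apply: galgP => g; rewrite !gcoef_mul.
under eq_bigr => h _.
  rewrite gcoef_mul mulr_sumr (reindex_inj (mulgI h^-1%g)) /=.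
  under eq_bigr => k _ do rewrite invMg invgK -mulgA mulKVg mulrA.
  over.
rewrite exchange_big /=; apply: eq_bigr => k _.
by rewrite gcoef_mul mulr_suml.
Qed.

Lemma galg_mul1l : left_id (gelt 1%g) galg_mul.
Proof.
move=> a; apply: galgP => g; rewrite gcoef_mul (bigD1 1%g) //= gcoef_elt eqxx.
rewrite mul1r invg1 mul1g big1 ?addr0 // => h /negPf h1.
by rewrite gcoef_elt h1 mul0r.
Qed.

Lemma galg_mul1r : right_id (gelt 1%g) galg_mul.
Proof.
move=> a; apply: galgP => g; rewrite gcoef_mul (bigD1 g) //= gcoef_elt.
rewrite mulVg eqxx mulr1 big1 ?addr0 // => h /negPf hg.
by rewrite gcoef_elt -eq_mulVg1 hg mulr0.
Qed.

Lemma galg_mulDl : left_distributive galg_mul +%R.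
Proof.
move=> a b c; apply: galgP => g; rewrite gcoefD !gcoef_mul -big_split /=.
by apply: eq_bigr => h _; rewrite gcoefD mulrDl.
Qed.

Lemma galg_mulDr : right_distributive galg_mul +%R.
Proof.
move=> a b c; apply: galgP => g; rewrite gcoefD !gcoef_mul -big_split /=.
by apply: eq_bigr => h _; rewrite gcoefD mulrDr.
Qed.

End GroupAlgebra.

HB.instance Definition _ (R : comPzRingType) (G : finGroupType) :=
  GRing.Zmodule_isPzRing.Build (galg R G)
    (@galg_mulA R G) (@galg_mul1l R G) (@galg_mul1r R G)
    (@galg_mulDl R G) (@galg_mulDr R G).

(* The R-linear extension R[G] -> R[H] of a map of sets f : G -> H. *)
Definition galg_map (R : comPzRingType) (G H : finGroupType) (f : G -> H)
    (a : galg R G) : galg R H :=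
  \sum_(g : G) gcoef a g *: gelt R (f g).

Section Diagonal.
Variables (R : comPzRingType) (G : finGroupType).

Definition Delta : galg R G -> galg R (G * G)%type :=
  galg_map (fun g : G => (g, g)).

Definition id_ox_Delta : galg R (G * G)%type -> galg R (G * G * G)%type :=
  galg_map (fun u : G * G => (u.1, u.2, u.2)).

Definition Delta_ox_id : galg R (G * G)%type -> galg R (G * G * G)%type :=
  galg_map (fun u : G * G => (u.1, u.1, u.2)).

Definition one_ox : galg R (G * G)%type -> galg R (G * G * G)%type :=
  galg_map (fun u : G * G => (1%g, u.1, u.2)).

Definition ox_one : galg R (G * G)%type -> galg R (G * G * G)%type :=
  galg_map (fun u : G * G => (u.1, u.2, 1%g)).

End Diagonal.

(* The tensor product over R.  A formal sum of the x_i (x) y_i is a sequence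
   of pairs; tensor_rel is the least congruence (for concatenation, up to
   order) imposing R-bilinearity.  Negatives need not be adjoined:
   x (x) y + (- x) (x) y = 0.  The universal property is given by tens_liftE
   and tens_ext. *)
Section Tensor.
Variables (R : comPzRingType) (X Y : lmodType R).
Implicit Types (x : X) (y : Y) (s t : seq (X * Y)).

Inductive tensor_rel : seq (X * Y) -> seq (X * Y) -> Prop :=
| trel_sym s t : tensor_rel s t -> tensor_rel t s
| trel_trans s t u : tensor_rel s t -> tensor_rel t u -> tensor_rel s u
| trel_perm s t : perm_eq s t -> tensor_rel s t
| trel_cat s s' t t' :
    tensor_rel s s' -> tensor_rel t t' -> tensor_rel (s ++ t) (s' ++ t')
| trel_0l y : tensor_rel [:: (0, y)] [::]
| trel_Dl x x' y : tensor_rel [:: (x + x', y)] [:: (x, y); (x', y)]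
| trel_Dr x y y' : tensor_rel [:: (x, y + y')] [:: (x, y); (x, y')]
| trel_Z (r : R) x y : tensor_rel [:: (r *: x, y)] [:: (x, r *: y)].

Definition tensor_eqv s t : bool := `[< tensor_rel s t >].

Lemma tensor_eqv_equiv : equiv_class_of tensor_eqv.
Proof.
split=> [s|s t|t s u].
- exact/asboolP/trel_perm.
- by apply/asboolP/asboolP => /trel_sym.
- by move=> /asboolP st /asboolP tu; apply/asboolP/(trel_trans st tu).
Qed.

Canonical tensor_eqv_rel := EquivRelPack tensor_eqv_equiv.
Canonical tensor_encModRel := defaultEncModRel tensor_eqv.

Definition tensor := {eq_quot tensor_eqv}.

HB.instance Definition _ : EqQuotient _ tensor_eqv tensor :=
  EqQuotient.on tensor.
HB.instance Definition _ := Choice.on tensor.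

Lemma tensor_piP s t : tensor_rel s t <-> \pi_tensor s = \pi_tensor t.
Proof.
split=> [st|/eqP]; first by apply/eqmodP/asboolP.
by rewrite eqmodE => /asboolP.
Qed.

Lemma trel_repr s : tensor_rel (repr (\pi_tensor s)) s.
Proof. by apply/tensor_piP; rewrite reprK. Qed.

Definition scale_pairs (r : R) s := [seq (r *: p.1, p.2) | p <- s].

Lemma trel_scale r s t :
  tensor_rel s t -> tensor_rel (scale_pairs r s) (scale_pairs r t).
Proof.
elim=> {s t} /=.
- by move=> s t _; apply: trel_sym.
- by move=> s t u _ st _; apply: trel_trans st.
- by move=> s t p; apply/trel_perm/perm_map.
- by move=> s s' t t' _ ss _ tt; rewrite /scale_pairs !map_cat; apply: trel_cat.
- by move=> y; rewrite scaler0; apply: trel_0l.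
- by move=> x x' y; rewrite scalerDr; apply: trel_Dl.
- by move=> x y y'; apply: trel_Dr.
- by move=> r' x y; rewrite scalerA mulrC -scalerA; apply: trel_Z.
Qed.

Definition tens x y : tensor := \pi_tensor [:: (x, y)].
Definition tensor0 : tensor := \pi_tensor [::].
Definition tensor_add := lift_op2 tensor cat.
Definition tensor_scale (r : R) := lift_op1 tensor (scale_pairs r).
Definition tensor_opp (u : tensor) : tensor := tensor_scale (-1) u.

Lemma pi_tensor_add s t :
  tensor_add (\pi_tensor s) (\pi_tensor t) = \pi_tensor (s ++ t).
Proof.
by unlock tensor_add; apply/tensor_piP/trel_cat; apply: trel_repr.
Qed.

Lemma pi_tensor_scale r s :
  tensor_scale r (\pi_tensor s) = \pi_tensor (scale_pairs r s).
Proof. by unlock tensor_scale; apply/tensor_piP/trel_scale/trel_repr. Qed.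

Lemma tensor_addA : associative tensor_add.
Proof.
move=> u v w; rewrite -[u]reprK -[v]reprK -[w]reprK.
by rewrite !pi_tensor_add catA.
Qed.

Lemma tensor_addC : commutative tensor_add.
Proof.
move=> u v; rewrite -[u]reprK -[v]reprK !pi_tensor_add.
by apply/tensor_piP/trel_perm; rewrite perm_catC.
Qed.

Lemma tensor_add0 : left_id tensor0 tensor_add.
Proof. by move=> u; rewrite -[u]reprK pi_tensor_add. Qed.

Lemma tensor_ind (P : tensor -> Prop) :
  P tensor0 -> (forall x y u, P u -> P (tensor_add (tens x y) u)) ->
  forall u, P u.
Proof.
move=> P0 PD u; rewrite -[u]reprK; elim: (repr u) => [|[x y] s IH] //.
by rewrite -cat1s -pi_tensor_add; apply: PD.
Qed.

Lemma tensor_scaleDr r : {morph tensor_scale r : u v / tensor_add u v}.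
Proof.
move=> u v; rewrite -[u]reprK -[v]reprK !(pi_tensor_add, pi_tensor_scale).
by rewrite /scale_pairs map_cat.
Qed.

Lemma tensor_scale0 r : tensor_scale r tensor0 = tensor0.
Proof. by rewrite pi_tensor_scale. Qed.

Lemma tensor_scaleDl (r r' : R) u :
  tensor_scale (r + r') u = tensor_add (tensor_scale r u) (tensor_scale r' u).
Proof.
elim/tensor_ind: u => [|x y u IH].
  by rewrite !tensor_scale0 tensor_add0.
have -> : forall v w, tensor_add (tensor_scale r (tensor_add v w))
    (tensor_scale r' (tensor_add v w)) =
    tensor_add (tensor_add (tensor_scale r v) (tensor_scale r' v))
    (tensor_add (tensor_scale r w) (tensor_scale r' w)).
  move=> v w; rewrite !tensor_scaleDr -!tensor_addA; congr (tensor_add _ _).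
  by rewrite tensor_addA [tensor_add _ (tensor_scale r' v)]tensor_addC
             -tensor_addA.
rewrite tensor_scaleDr IH; congr (tensor_add _ _).
rewrite !pi_tensor_scale pi_tensor_add /= scalerDl.
exact/tensor_piP/trel_Dl.
Qed.

Lemma tensor_scale0l u : tensor_scale 0 u = tensor0.
Proof.
elim/tensor_ind: u => [|x y u IH]; first exact: tensor_scale0.
rewrite tensor_scaleDr IH tensor_addC tensor_add0 pi_tensor_scale /= scale0r.
exact/tensor_piP/trel_0l.
Qed.

Lemma tensor_scaleA (r r' : R) u :
  tensor_scale r (tensor_scale r' u) = tensor_scale (r * r') u.
Proof.
rewrite -[u]reprK !pi_tensor_scale /scale_pairs -map_comp.
by congr (\pi_tensor _); apply: eq_map => p /=; rewrite scalerA.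
Qed.

Lemma tensor_scale1 : left_id 1 tensor_scale.
Proof.
move=> u; rewrite -[u]reprK pi_tensor_scale /scale_pairs.
rewrite -[in RHS](map_id (repr u)); congr (\pi_tensor _).
by apply: eq_map => -[x y] /=; rewrite scale1r.
Qed.

Lemma tensor_addN : left_inverse tensor0 tensor_opp tensor_add.
Proof.
move=> u; rewrite -{2}[u]tensor_scale1 -tensor_scaleDl addNr.
exact: tensor_scale0l.
Qed.

HB.instance Definition _ :=
  GRing.isZmodule.Build tensor tensor_addA tensor_addC tensor_add0 tensor_addN.

HB.instance Definition _ :=
  GRing.Zmodule_isLmodule.Build R tensor
    tensor_scaleA tensor_scale1 tensor_scaleDr
    (fun u r r' => tensor_scaleDl r r' u).

Lemma tensDl x x' y : tens (x + x') y = tens x y + tens x' y.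
Proof. by rewrite [RHS]pi_tensor_add; apply/tensor_piP/trel_Dl. Qed.

Lemma tensDr x y y' : tens x (y + y') = tens x y + tens x y'.
Proof. by rewrite [RHS]pi_tensor_add; apply/tensor_piP/trel_Dr. Qed.

Lemma tensZl (r : R) x y : tens (r *: x) y = r *: tens x y.
Proof. by rewrite [RHS]pi_tensor_scale. Qed.

Lemma tensZr (r : R) x y : tens x (r *: y) = r *: tens x y.
Proof. by rewrite -tensZl; apply/esym/tensor_piP/trel_Z. Qed.

Lemma tens0l y : tens 0 y = 0.
Proof. by rewrite -(scale0r 0) tensZl scale0r. Qed.

Lemma tens0r x : tens x 0 = 0.
Proof. by rewrite -(scale0r 0) tensZr scale0r. Qed.

Lemma tens_ind (P : tensor -> Prop) :
  P 0 -> (forall x y u, P u -> P (tens x y + u)) -> forall u, P u.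
Proof. exact: tensor_ind. Qed.

Lemma tens_ext (W : lmodType R) (f f' : {linear tensor -> W}) :
  (forall x y, f (tens x y) = f' (tens x y)) -> f =1 f'.
Proof.
move=> eqf u; elim/tens_ind: u => [|x y u IH]; first by rewrite !linear0.
by rewrite !linearD eqf IH.
Qed.

End Tensor.

Definition bilinear_map (R : comPzRingType) (X Y W : lmodType R)
    (f : X -> Y -> W) : Prop :=
  (forall x, linear (f x)) /\ (forall y, linear (fun x => f x y)).

Section TensorLift.
Variables (R : comPzRingType) (X Y W : lmodType R) (f : X -> Y -> W).
Hypothesis f_bil : bilinear_map f.

Definition tens_lift_fun (u : tensor X Y) : W :=
  \sum_(p <- repr u) f p.1 p.2.

Let fl y : {linear X -> W} :=
  HB.pack (fun x => f x y) (GRing.isLinear.Build R X W *:%R _ (f_bil.2 y)).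
Let fr x : {linear Y -> W} :=
  HB.pack (f x) (GRing.isLinear.Build R Y W *:%R _ (f_bil.1 x)).

Lemma trel_lift (s t : seq (X * Y)) :
  tensor_rel s t -> \sum_(p <- s) f p.1 p.2 = \sum_(p <- t) f p.1 p.2.
Proof.
elim=> {s t} //=.
- by move=> s t u _ -> _ ->.
- by move=> s t p; apply: perm_big.
- by move=> s s' t t' _ eqs _ eqt; rewrite !big_cat /= eqs eqt.
- by move=> y; rewrite big_seq1 big_nil -[LHS]/(fl y 0) linear0.
- move=> x x' y; rewrite big_seq1 big_cons big_seq1 /=.
  exact: (linearD (fl y)).
- move=> x y y'; rewrite big_seq1 big_cons big_seq1 /=.
  exact: (linearD (fr x)).
- move=> r x y; rewrite !big_seq1 /=.
  by rewrite -[LHS]/(fl y (r *: x)) -[RHS]/(fr x (r *: y)) !linearZ.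
Qed.

Lemma pi_tens_lift s :
  tens_lift_fun (\pi_(tensor X Y) s) = \sum_(p <- s) f p.1 p.2.
Proof. exact/trel_lift/trel_repr. Qed.

Lemma tens_lift_linear : linear tens_lift_fun.
Proof.
move=> r u v; rewrite -[u]reprK -[v]reprK.
rewrite [r *: _]pi_tensor_scale [_ + _ in LHS]pi_tensor_add !pi_tens_lift.
rewrite big_cat /= big_map scaler_sumr; congr (_ + _); apply: eq_bigr => p _.
exact: (linearZ_LR (fl p.2)).
Qed.

Definition tens_lift : {linear tensor X Y -> W} :=
  HB.pack tens_lift_fun
    (GRing.isLinear.Build R (tensor X Y) W *:%R _ tens_lift_linear).

Lemma tens_liftE x y : tens_lift (tens x y) = f x y.
Proof. by rewrite -[LHS]/(tens_lift_fun _) pi_tens_lift big_seq1. Qed.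

End TensorLift.

(* f (x) g, the linear map with x (x) y |-> f x (x) g y *)
Section TensorMap.
Variables (R : comPzRingType) (X X' Y Y' : lmodType R).
Variables (f : {linear X -> X'}) (g : {linear Y -> Y'}).

Lemma tens_map_bil : bilinear_map (fun x y => tens (f x) (g y)).
Proof.
by split=> [x|y] r u v; rewrite linearP ?tensDr ?tensDl ?tensZr ?tensZl.
Qed.

Definition tens_map : {linear tensor X Y -> tensor X' Y'} :=
  tens_lift tens_map_bil.

Lemma tens_mapE x y : tens_map (tens x y) = tens (f x) (g y).
Proof. exact: tens_liftE. Qed.

End TensorMap.

Section Associator.
Variables (R : comPzRingType) (X Y Z : lmodType R).

Lemma tens_assoc_bil1 z :
  bilinear_map (fun (x : X) (y : Y) => tens x (tens y (z : Z))).
Proof. by split=> [x|y] r u v; rewrite !(tensDl, tensDr, tensZl, tensZr). Qed.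

Lemma tens_assoc_bil :
  bilinear_map (fun (u : tensor X Y) (z : Z) => tens_lift (tens_assoc_bil1 z) u).
Proof.
split=> [u|z] r; last exact: linearP.
move=> z z'; elim/tens_ind: u => [|x y u IH].
  by rewrite !linear0 addr0.
rewrite !linearD IH !tens_liftE !(tensDl, tensDr, tensZl, tensZr).
exact: addrACA.
Qed.

Definition tens_assoc : {linear tensor (tensor X Y) Z -> tensor X (tensor Y Z)} :=
  tens_lift tens_assoc_bil.

Lemma tens_assocE x y z : tens_assoc (tens (tens x y) z) = tens x (tens y z).
Proof. by rewrite !tens_liftE. Qed.

Lemma tens_assoc_inv_bil1 x :
  bilinear_map (fun (y : Y) (z : Z) => tens (tens (x : X) y) z).
Proof. by split=> [y|z] r u v; rewrite !(tensDl, tensDr, tensZl, tensZr). Qed.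

Lemma tens_assoc_inv_bil :
  bilinear_map (fun (x : X) (u : tensor Y Z) =>
    tens_lift (tens_assoc_inv_bil1 x) u).
Proof.
split=> [x|u] r; first exact: linearP.
move=> x x'; elim/tens_ind: u => [|y z u IH].
  by rewrite !linear0 addr0.
rewrite !linearD IH !tens_liftE !(tensDl, tensDr, tensZl, tensZr).
exact: addrACA.
Qed.

Definition tens_assoc_inv :
    {linear tensor X (tensor Y Z) -> tensor (tensor X Y) Z} :=
  tens_lift tens_assoc_inv_bil.

Lemma tens_assoc_invE x y z :
  tens_assoc_inv (tens x (tens y z)) = tens (tens x y) z.
Proof. by rewrite !tens_liftE. Qed.

Lemma tens_assocK : cancel tens_assoc tens_assoc_inv.
Proof.
move=> w; elim/tens_ind: w => [|u z w IH]; first by rewrite !linear0.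
rewrite !linearD IH; congr (_ + _); elim/tens_ind: u => [|x y u IHu].
  by rewrite tens0l !linear0.
by rewrite tensDl !linearD IHu tens_assocE tens_assoc_invE.
Qed.

Lemma tens_assoc_invK : cancel tens_assoc_inv tens_assoc.
Proof.
move=> w; elim/tens_ind: w => [|x u w IH]; first by rewrite !linear0.
rewrite !linearD IH; congr (_ + _); elim/tens_ind: u => [|y z u IHu].
  by rewrite tens0r !linear0.
by rewrite tensDr !linearD IHu tens_assoc_invE tens_assocE.
Qed.

End Associator.

Record gmodule (R : comPzRingType) (G : finGroupType) := GModule {
  gmod_sort :> lmodType R;
  gact : G -> {linear gmod_sort -> gmod_sort};
  gact1 : forall x, gact 1%g x = x;
  gactM : forall g h x, gact (g * h)%g x = gact g (gact h x)
}.

Section GModules.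
Variables (R : comPzRingType) (G : finGroupType).

Definition galg_act (X : gmodule R G) (a : galg R G) (x : X) : X :=
  \sum_(g : G) gcoef a g *: gact X g x.

Definition finitely_generated (X : gmodule R G) : Prop :=
  exists s : seq X, forall x : X, exists a : 'I_(size s) -> galg R G,
    x = \sum_(i < size s) galg_act (a i) s`_i.

Record gHom (X Y : gmodule R G) := GHom {
  ghom_fun :> {linear X -> Y};
  ghom_act : forall g x, ghom_fun (gact X g x) = gact Y g (ghom_fun x)
}.

Definition gtensor_act (X Y : gmodule R G) (g : G) :
    {linear tensor X Y -> tensor X Y} :=
  tens_map (gact X g) (gact Y g).

Lemma gtensor_act1 (X Y : gmodule R G) u : gtensor_act X Y 1%g u = u.
Proof.
elim/tens_ind: u => [|x y u IH]; first exact: linear0.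
by rewrite linearD IH /gtensor_act tens_mapE !gact1.
Qed.

Lemma gtensor_actM (X Y : gmodule R G) g h u :
  gtensor_act X Y (g * h)%g u = gtensor_act X Y g (gtensor_act X Y h u).
Proof.
elim/tens_ind: u => [|x y u IH]; first by rewrite !linear0.
by rewrite !linearD IH /gtensor_act !tens_mapE !gactM.
Qed.

Definition gtensor (X Y : gmodule R G) : gmodule R G :=
  GModule (@gtensor_act1 X Y) (@gtensor_actM X Y).

Definition gunit : gmodule R G :=
  @GModule R G R^o (fun=> idfun) (fun=> erefl) (fun _ _ _ => erefl).

Lemma galg_act_elt (X : gmodule R G) g (x : X) :
  galg_act (gelt R g) x = gact X g x.
Proof.
rewrite /galg_act (bigD1 g) //= gcoef_elt eqxx scale1r big1 ?addr0 //.
by move=> h /negPf hg; rewrite gcoef_elt hg scale0r.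
Qed.

Lemma finitely_generatedP (X : gmodule R G) :
  (exists s : seq X, forall P : X -> Prop, P 0 ->
     (forall x y, P x -> P y -> P (x + y)) ->
     (forall (r : R) x, P x -> P (r *: x)) ->
     (forall g x, P x -> P (gact X g x)) ->
     (forall x, x \in s -> P x) -> forall x, P x) <->
  finitely_generated X.
Proof.
split=> [[s gen_s]|[s gen_s]]; exists s.
- apply: gen_s.
  + exists (fun=> 0); rewrite big1 // => i _; rewrite /galg_act big1 // => g _.
    by rewrite /gcoef ffunE scale0r.
  + move=> x y [a ->] [b ->]; exists (fun i => a i + b i).
    rewrite -big_split; apply: eq_bigr => i _; rewrite /galg_act -big_split.
    by apply: eq_bigr => g _; rewrite gcoefD scalerDl.
  + move=> r x [a ->]; exists (fun i => r *: a i).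
    rewrite scaler_sumr; apply: eq_bigr => i _; rewrite scaler_sumr.
    by apply: eq_bigr => g _; rewrite gcoefZ scalerA.
  + move=> g x [a ->]; exists (fun i => gelt R g * a i).
    rewrite linear_sum; apply: eq_bigr => i _; rewrite linear_sum.
    rewrite /galg_act [RHS](reindex_inj (mulgI g)); apply: eq_bigr => h _ /=.
    rewrite linearZ -gactM; congr (_ *: _).
    rewrite -[_ * a i]/(galg_mul _ _) gcoef_mul (bigD1 g) //= gcoef_elt eqxx.
    rewrite mul1r mulKg big1 ?addr0 // => k /negPf kg.
    by rewrite gcoef_elt kg mul0r.
  + move=> x sx; have lt_xs : (index x s < size s)%N by rewrite index_mem.
    exists (fun i => if i == Ordinal lt_xs then gelt R 1%g else 0).
    rewrite (bigD1 (Ordinal lt_xs)) //= eqxx galg_act_elt gact1 nth_index //.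
    rewrite big1 ?addr0 // => i /negPf ->; rewrite /galg_act big1 // => g _.
    by rewrite /gcoef ffunE scale0r.
- move=> P P0 PD PZ Pact Ps x; have [a ->] := gen_s x.
  apply: big_ind => // i _; apply: big_ind => // g _.
  by apply/PZ/Pact/Ps/mem_nth.
Qed.

Lemma gtensor_fg (X Y : gmodule R G) :
  finitely_generated X -> finitely_generated Y ->
  finitely_generated (gtensor X Y).
Proof.
move=> /finitely_generatedP[s gen_s] /finitely_generatedP[t gen_t].
apply/finitely_generatedP.
exists [seq tens x z | x <- s, z <- [seq gact Y g y | g <- enum G, y <- t]].
move=> P P0 PD PZ Pact Pst u.
suff Ptens x y : P (tens x y).
  by elim/tens_ind: u => // x y u Pu; apply: PD.
have Pact2 g x' y' : P (tens x' (gact Y g^-1%g y')) -> P (tens (gact X g x') y').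
  by move=> /(Pact g); rewrite [gact _ g _]tens_mapE -gactM mulgV gact1.
move: x y; apply: (gen_s (fun x => forall y, P (tens x y))).
- by move=> y; rewrite tens0l.
- by move=> x x' Px Px' y; rewrite tensDl; apply: PD.
- by move=> r x Px y; rewrite tensZl; apply: PZ.
- by move=> g x Px y; apply: Pact2.
move=> x sx y; rewrite -[y]gact1; move: y 1%g.
apply: (gen_t (fun y => forall g, P (tens x (gact Y g y)))).
- by move=> g; rewrite linear0 tens0r.
- by move=> y y' Py Py' g; rewrite linearD tensDr; apply: PD.
- by move=> r y Py g; rewrite linearZ_LR tensZr; apply: PZ.
- by move=> h y Py g; rewrite -gactM.
move=> y ty g; apply: Pst; apply: allpairs_f => //.
by apply: allpairs_f; rewrite ?mem_enum.
Qed.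

Lemma gunit_fg : finitely_generated gunit.
Proof.
apply/finitely_generatedP; exists [:: 1 : R^o] => P _ _ PZ _ P1 x.
by rewrite -[x]mulr1; apply/PZ/P1; rewrite inE.
Qed.

End GModules.

(* The objects of Mod_R(G); the morphisms are those of gHom. *)
Record fg_gmodule (R : comPzRingType) (G : finGroupType) := FgGModule {
  fg_gmod :> gmodule R G;
  fg_gmodP : finitely_generated fg_gmod
}.

Section MonoidalCategory.
Variables (R : comPzRingType) (G : finGroupType).
Implicit Types X Y Z : fg_gmodule R G.

Definition otimes X Y : fg_gmodule R G :=
  FgGModule (gtensor_fg (fg_gmodP X) (fg_gmodP Y)).

Definition unit_obj : fg_gmodule R G := FgGModule (gunit_fg R G).

Definition unit_elt : unit_obj := (1 : R^o).

(* The action of R[G x G] on X (x) Y: (g, h) . (x (x) y) = g x (x) h y *)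
Definition galg2_act X Y (q : galg R (G * G)%type) (t : otimes X Y) :
    otimes X Y :=
  \sum_(u : G * G) gcoef q u *: tens_map (gact X u.1) (gact Y u.2) t.

Record quantization := Quantization {
  quant_hom :> forall X Y, gHom (otimes X Y) (otimes X Y);
  quant_natural : forall X X' Y Y' (f : gHom X X') (g : gHom Y Y')
    (t : otimes X Y),
    quant_hom X' Y' (tens_map f g t) = tens_map f g (quant_hom X Y t);
  quant_coherent : forall X Y Z (t : otimes (otimes X Y) Z),
    quant_hom X (otimes Y Z)
      (tens_map idfun (quant_hom Y Z) (tens_assoc X Y Z t)) =
    tens_assoc X Y Z
      (quant_hom (otimes X Y) Z (tens_map (quant_hom X Y) idfun t));
  quant_unitr : forall X (t : otimes X unit_obj),
    quant_hom X unit_obj t = t;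
  quant_unitl : forall X (t : otimes unit_obj X),
    quant_hom unit_obj X t = t
}.

(* As the x (x) y span X (x) Y, there is at most one such quantization. *)
Definition defines_quantization (q : galg R (G * G)%type) : Prop :=
  exists Q : quantization, forall X Y (x : X) (y : Y),
    Q X Y (tens x y) = galg2_act q (tens x y).

End MonoidalCategory.

(* Main.v *)
From HB Require Import structures.
Require Import Defs.
From mathcomp Require Import all_boot all_order all_algebra all_fingroup.
Import GRing.Theory Defs.
Local Open Scope ring_scope.

Set Implicit Arguments.
Unset Strict Implicit.
Unset Printing Implicit Defensive.

(** The idea is to see X (x) Y as a module over R[G x G], and X (x) Y (x) Z as
    one over R[G x G x G], so that q acts by the general action [galg_act] of a
    group algebra.  The product of a group algebra becomes composition
    ([galg_act_mul]), and G-module maps f and g make f (x) g commute with the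
    action of q ([galg2_act_natural]), so that naturality in X and Y is
    automatic for every q.

    The four edges of the coherence diagram at X, Y, Z are the actions on
    X (x) Y (x) Z of the four images of q in R[G x G x G] ([Delta_ox_id_act],
    [ox_one_act], [id_ox_Delta_act], [one_ox_act]); hence the diagram says that
    the two sides of condition (1) act equally ([coherent_iff]).  Likewise
    Delta g acts as g does on X (x) Y ([Delta_elt_act]), so G-linearity of the
    action of q says that the two sides of condition (3) act equally.
    Conditions (1) and (3) therefore give coherence and G-linearity, and (2)
    gives the unit axioms because x (x) r = r (x (x) 1).

    For the converse, an equality of actions has to give an equality in the
    group algebra.  Take X = Y = Z = R[G], the regular module, which is
    generated by 1.  There is an equivariant map from R[G] (x) R[G] to R[G x G]
    sending 1 (x) 1 to 1 ([box_regular], [box_regular1]), and similarly for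
    three factors; it sends p . (1 (x) 1) to p, so p is recovered from its
    action ([galg_eq_by_action]).  Condition (2) is an instance of the unit
    axioms. *)

(** * Group algebras and their modules *)

Lemma gcoef_eltM (R : comPzRingType) (G : finGroupType) g (a : galg R G) h :
  gcoef (gelt R g * a) h = gcoef a (g^-1 * h)%g.
Proof.
rewrite -[_ * a]/(galg_mul _ _) gcoef_mul (bigD1 g) //= gcoef_elt eqxx mul1r.
by rewrite big1 ?addr0 // => k /negPf kg; rewrite gcoef_elt kg mul0r.
Qed.

Lemma gelt_mul (R : comPzRingType) (G : finGroupType) (g h : G) :
  gelt R g * gelt R h = gelt R (g * h)%g.
Proof.
apply: galgP => k; rewrite gcoef_eltM !gcoef_elt.
by rewrite -(inj_eq (mulgI g)) mulKVg.
Qed.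

Lemma galg_scaleAl (R : comPzRingType) (G : finGroupType) r (a b : galg R G) :
  r *: a * b = r *: (a * b).
Proof.
apply: galgP => g; rewrite gcoefZ -[_ * b]/(galg_mul _ _).
rewrite -[a * b]/(galg_mul _ _) !gcoef_mul mulr_sumr; apply: eq_bigr => h _.
by rewrite gcoefZ mulrA.
Qed.

Lemma gcoef_sum (R : comPzRingType) (G : finGroupType) (I : finType)
    (F : I -> galg R G) h :
  gcoef (\sum_i F i) h = \sum_i gcoef (F i) h.
Proof.
apply: (big_morph (fun b => gcoef b h)) => [a b|]; first exact: gcoefD.
by rewrite /gcoef ffunE.
Qed.

Lemma galg_sum_elt (R : comPzRingType) (G : finGroupType) (a : galg R G) :
  a = \sum_(g : G) gcoef a g *: gelt R g.
Proof.
apply: galgP => h; rewrite gcoef_sum (bigD1 h) //= gcoefZ gcoef_elt eqxx mulr1.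
rewrite big1 ?addr0 // => g gh.
by rewrite gcoefZ gcoef_elt eq_sym (negPf gh) mulr0.
Qed.

Lemma galg_map_elt (R : comPzRingType) (G H : finGroupType) (f : G -> H) g :
  galg_map f (gelt R g) = gelt R (f g).
Proof.
rewrite /galg_map (bigD1 g) //= gcoef_elt eqxx scale1r big1 ?addr0 //.
by move=> h /negPf hg; rewrite gcoef_elt hg scale0r.
Qed.

Lemma galg_act_is_linear (R : comPzRingType) (G : finGroupType)
    (X : gmodule R G) (a : galg R G) : linear (galg_act (X := X) a).
Proof.
move=> r x y; rewrite /galg_act scaler_sumr -big_split.
apply: eq_bigr => g _ /=.
by rewrite linearP scalerDr !scalerA [gcoef a g * r]mulrC.
Qed.

Definition galg_lin (R : comPzRingType) (G : finGroupType)
    (X : gmodule R G) (a : galg R G) : {linear X -> X} :=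
  HB.pack (galg_act (X := X) a)
    (GRing.isLinear.Build R X X *:%R _ (@galg_act_is_linear R G X a)).

Lemma galg_actDl (R : comPzRingType) (G : finGroupType) (X : gmodule R G)
    (a b : galg R G) (x : X) :
  galg_act (a + b) x = galg_act a x + galg_act b x.
Proof.
rewrite /galg_act -big_split; apply: eq_bigr => g _.
by rewrite gcoefD scalerDl.
Qed.

Lemma galg_actZl (R : comPzRingType) (G : finGroupType) (X : gmodule R G)
    r (a : galg R G) (x : X) :
  galg_act (r *: a) x = r *: galg_act a x.
Proof.
rewrite /galg_act scaler_sumr; apply: eq_bigr => g _.
by rewrite gcoefZ scalerA.
Qed.

Lemma galg_act_suml (R : comPzRingType) (G : finGroupType) (X : gmodule R G)
    (I : finType) (F : I -> galg R G) (x : X) :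
  galg_act (\sum_i F i) x = \sum_i galg_act (F i) x.
Proof.
apply: (big_morph (fun a => galg_act a x)) => [a b|]; first exact: galg_actDl.
by rewrite -(scale0r 0) galg_actZl scale0r.
Qed.

(** Delta, 1 (x) Delta, Delta (x) 1, 1 (x) - and - (x) 1 are all of the form
    [galg_map f], so this one formula computes the action of their values. *)
Lemma galg_act_map (R : comPzRingType) (G H : finGroupType) (f : G -> H)
    (X : gmodule R H) (a : galg R G) (x : X) :
  galg_act (galg_map f a) x = \sum_(g : G) gcoef a g *: gact X (f g) x.
Proof.
rewrite galg_act_suml; apply: eq_bigr => g _.
by rewrite galg_actZl galg_act_elt.
Qed.

(** Both arguments are sums of group elements, for which this is the action law
    of X. *)
Lemma galg_act_mul (R : comPzRingType) (G : finGroupType) (X : gmodule R G)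
    (a b : galg R G) (x : X) :
  galg_act (a * b) x = galg_act a (galg_act b x).
Proof.
have eltM g : galg_act (gelt R g * b) x = gact X g (galg_act b x).
  rewrite {1}[b]galg_sum_elt mulr_sumr galg_act_suml linear_sum.
  apply: eq_bigr => h _ /=.
  have -> : gelt R g * (gcoef b h *: gelt R h) =
            gcoef b h *: gelt R (g * h)%g.
    apply: galgP => k.
    by rewrite -gelt_mul gcoef_eltM !gcoefZ gcoef_eltM.
  by rewrite galg_actZl galg_act_elt gactM linearZ.
rewrite {1}[a]galg_sum_elt mulr_suml galg_act_suml; apply: eq_bigr => g _.
by rewrite galg_scaleAl galg_actZl eltM.
Qed.

Lemma ghom_galg_act (R : comPzRingType) (G : finGroupType) (X Y : gmodule R G)
    (f : gHom X Y) (a : galg R G) (x : X) :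
  f (galg_act a x) = galg_act a (f x).
Proof.
rewrite linear_sum; apply: eq_bigr => g _.
by rewrite linearZ ghom_act.
Qed.

Lemma lmul_elt_linear (R : comPzRingType) (G : finGroupType) (g : G) :
  linear (fun a : galg R G => gelt R g * a).
Proof.
by move=> r a b; apply: galgP => h; rewrite !(gcoef_eltM, gcoefD, gcoefZ).
Qed.

Definition lmul_elt (R : comPzRingType) (G : finGroupType) (g : G) :
    {linear galg R G -> galg R G} :=
  HB.pack (fun a : galg R G => gelt R g * a)
    (GRing.isLinear.Build R (galg R G) (galg R G) *:%R _
      (@lmul_elt_linear R G g)).

Lemma lmul_elt1 (R : comPzRingType) (G : finGroupType) (a : galg R G) :
  lmul_elt R (1%g : G) a = a.
Proof. exact: mul1r. Qed.

Lemma lmul_eltM (R : comPzRingType) (G : finGroupType) (g h : G)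
    (a : galg R G) :
  lmul_elt R (g * h)%g a = lmul_elt R g (lmul_elt R h a).
Proof. by rewrite /= -gelt_mul mulrA. Qed.

Definition regular (R : comPzRingType) (G : finGroupType) : gmodule R G :=
  GModule (@lmul_elt1 R G) (@lmul_eltM R G).

Lemma galg_act_regular (R : comPzRingType) (G : finGroupType)
    (a : galg R G) (b : regular R G) :
  galg_act a b = a * b.
Proof.
rewrite {2}[a]galg_sum_elt mulr_suml; apply: eq_bigr => g _.
by rewrite galg_scaleAl.
Qed.

Lemma regular_fg (R : comPzRingType) (G : finGroupType) :
  finitely_generated (regular R G).
Proof.
exists [:: 1 : galg R G] => a; exists (fun=> a).
by rewrite big_ord1 galg_act_regular mulr1.
Qed.

Definition regular_obj (R : comPzRingType) (G : finGroupType) :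
    fg_gmodule R G :=
  FgGModule (regular_fg R G).

(** The image of p . m under f is p f(m) = p, so p can be read off from its
    action on the single element m. *)
Lemma galg_eq_by_action (R : comPzRingType) (G : finGroupType)
    (M : gmodule R G) (f : gHom M (regular R G)) (m : M) (p p' : galg R G) :
  f m = 1 -> galg_act p m = galg_act p' m -> p = p'.
Proof.
move=> fm1 /(congr1 f).
by rewrite !ghom_galg_act fm1 !galg_act_regular !mulr1.
Qed.

(** * External tensor products *)

Lemma tens_map_id (R : comPzRingType) (X Y : lmodType R)
    (f : {linear X -> X}) (g : {linear Y -> Y}) (t : tensor X Y) :
  f =1 id -> g =1 id -> tens_map f g t = t.
Proof.
move=> f1 g1; elim/tens_ind: t => [|x y t IH]; first exact: linear0.
by rewrite linearD IH tens_mapE f1 g1.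
Qed.

Lemma tens_map_comp (R : comPzRingType) (X X' X'' Y Y' Y'' : lmodType R)
    (f : {linear X -> X'}) (g : {linear Y -> Y'})
    (f' : {linear X' -> X''}) (g' : {linear Y' -> Y''})
    (h : {linear X -> X''}) (k : {linear Y -> Y''}) (t : tensor X Y) :
  h =1 f' \o f -> k =1 g' \o g ->
  tens_map h k t = tens_map f' g' (tens_map f g t).
Proof.
move=> eqh eqk; elim/tens_ind: t => [|x y t IH]; first by rewrite !linear0.
by rewrite !linearD IH !tens_mapE eqh eqk.
Qed.

(** The A x B-module structure on X (x) Y.  For A = B = G the action of q on
    [box X Y] is convertible to [galg2_act q], which lets the general results on
    [galg_act] apply to it. *)
Definition box_act (R : comPzRingType) (A B : finGroupType)
    (X : gmodule R A) (Y : gmodule R B) (u : A * B) :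
    {linear tensor X Y -> tensor X Y} :=
  tens_map (gact X u.1) (gact Y u.2).

Lemma box_act1 (R : comPzRingType) (A B : finGroupType)
    (X : gmodule R A) (Y : gmodule R B) (t : tensor X Y) :
  box_act X Y (1%g : A * B) t = t.
Proof. by apply: tens_map_id => x; apply: gact1. Qed.

Lemma box_actM (R : comPzRingType) (A B : finGroupType)
    (X : gmodule R A) (Y : gmodule R B) (u v : A * B) (t : tensor X Y) :
  box_act X Y (u * v)%g t = box_act X Y u (box_act X Y v t).
Proof. by apply: tens_map_comp => x; apply: gactM. Qed.

Definition box (R : comPzRingType) (A B : finGroupType)
    (X : gmodule R A) (Y : gmodule R B) : gmodule R (A * B)%type :=
  GModule (@box_act1 R A B X Y) (@box_actM R A B X Y).

Lemma box_tens (R : comPzRingType) (A B : finGroupType)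
    (X : gmodule R A) (Y : gmodule R B) (u : A * B) x y :
  gact (box X Y) u (tens x y) = tens (gact X u.1 x) (gact Y u.2 y).
Proof. exact: tens_mapE. Qed.

Lemma box_map_act (R : comPzRingType) (A B : finGroupType)
    (X X' : gmodule R A) (Y Y' : gmodule R B)
    (f : gHom X X') (g : gHom Y Y') (u : A * B) (t : box X Y) :
  tens_map f g (gact (box X Y) u t) =
  gact (box X' Y') u (tens_map f g t).
Proof.
elim/tens_ind: t => [|x y t IH]; first by rewrite !linear0.
rewrite !linearD IH; congr (_ + _).
by rewrite box_tens tens_mapE tens_mapE box_tens !ghom_act.
Qed.

Definition box_map (R : comPzRingType) (A B : finGroupType)
    (X X' : gmodule R A) (Y Y' : gmodule R B)
    (f : gHom X X') (g : gHom Y Y') :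
    gHom (box X Y) (box X' Y') :=
  @GHom R _ (box X Y) (box X' Y') (tens_map f g) (box_map_act f g).

(** The R-bilinear extension of the pairing that sends (g, h), with g in A and h
    in B, to (g, h) in A x B. *)
Definition ext_mul (R : comPzRingType) (A B : finGroupType)
    (a : galg R A) (b : galg R B) : galg R (A * B)%type :=
  [ffun u : A * B => gcoef a u.1 * gcoef b u.2 : R^o].

Lemma gcoef_ext_mul (R : comPzRingType) (A B : finGroupType)
    (a : galg R A) (b : galg R B) u :
  gcoef (ext_mul a b) u = gcoef a u.1 * gcoef b u.2.
Proof. by rewrite /gcoef ffunE. Qed.

Lemma ext_mul_bil (R : comPzRingType) (A B : finGroupType) :
  bilinear_map (@ext_mul R A B).
Proof.
split=> [a|b] r c d; apply: galgP => u;
  rewrite !(gcoef_ext_mul, gcoefD, gcoefZ).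
- by rewrite mulrDr mulrCA.
- by rewrite mulrDl mulrA.
Qed.

(** Left translation by (g, h) acts on the two coordinates separately, as the
    external action does on the two factors. *)
Lemma ext_mul_act (R : comPzRingType) (A B : finGroupType) (u : A * B)
    (t : box (regular R A) (regular R B)) :
  tens_lift (ext_mul_bil R A B) (gact (box _ _) u t) =
  gact (regular R (A * B)%type) u (tens_lift (ext_mul_bil R A B) t).
Proof.
elim/tens_ind: t => [|a b t IH]; first by rewrite !linear0.
rewrite !linearD IH; congr (_ + _); rewrite box_tens.
rewrite !tens_liftE; apply: galgP => v.
by rewrite gcoef_eltM !gcoef_ext_mul !gcoef_eltM.
Qed.

Definition box_regular (R : comPzRingType) (A B : finGroupType) :
    gHom (box (regular R A) (regular R B))
      (regular R (A * B)%type) :=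
  @GHom R _ (box (regular R A) (regular R B)) (regular R (A * B)%type)
    (tens_lift (ext_mul_bil R A B)) (@ext_mul_act R A B).

Lemma box_regular1 (R : comPzRingType) (A B : finGroupType) :
  box_regular R A B (tens (1 : galg R A) (1 : galg R B)) = 1.
Proof.
rewrite [LHS]tens_liftE; apply: galgP => u.
by rewrite gcoef_ext_mul !gcoef_elt -natrM mulnb -pair_eqE.
Qed.

Definition idhom (R : comPzRingType) (G : finGroupType) (X : gmodule R G) :
    gHom X X :=
  @GHom R G X X idfun (fun _ _ => erefl).

Definition comphom (R : comPzRingType) (G : finGroupType)
    (X Y Z : gmodule R G) (f : gHom Y Z) (g : gHom X Y) :
    gHom X Z.
Proof.
by exists (ghom_fun f \o ghom_fun g) => u x /=; rewrite !ghom_act.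
Defined.

Definition box_regular3 (R : comPzRingType) (A B C : finGroupType) :=
  comphom (box_regular R (A * B)%type C)
    (box_map (box_regular R A B) (idhom (regular R C))).

Lemma box_regular3_1 (R : comPzRingType) (A B C : finGroupType) :
  box_regular3 R A B C
    (tens (tens (1 : galg R A) (1 : galg R B)) (1 : galg R C)) = 1.
Proof.
pose f := box_map (box_regular R A B) (idhom (regular R C)).
have f1 : f (tens (tens (1 : galg R A) (1 : galg R B)) (1 : galg R C)) =
          tens (1 : galg R (A * B)%type) (1 : galg R C).
  by rewrite [LHS]tens_mapE box_regular1.
by rewrite -[LHS]/(box_regular R _ C (f _)) f1 box_regular1.
Qed.

(** * The action of elements of R[G x G] on tensor products *)

(** The map f (x) g is equivariant for all of G x G, not only for the
    diagonal. *)
Lemma galg2_act_natural (R : comPzRingType) (G : finGroupType)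
    (X X' Y Y' : fg_gmodule R G) (f : gHom X X') (g : gHom Y Y')
    (q : galg R (G * G)%type) (t : otimes X Y) :
  galg2_act (X := X') (Y := Y') q (tens_map f g t) =
  tens_map f g (galg2_act q t).
Proof. by rewrite [RHS](ghom_galg_act (box_map f g)). Qed.

Lemma Delta_elt_act (R : comPzRingType) (G : finGroupType)
    (X Y : fg_gmodule R G) (g : G) (t : otimes X Y) :
  galg_act (X := box X Y) (Delta (gelt R g)) t = gact (otimes X Y) g t.
Proof. by rewrite /Delta galg_map_elt galg_act_elt. Qed.

Lemma tens_assoc_gact (R : comPzRingType) (A B C : finGroupType)
    (X : gmodule R A) (Y : gmodule R B) (Z : gmodule R C)
    (u : A * B * C) (t : box (box X Y) Z) :
  tens_map (gact X u.1.1) (gact (box Y Z) (u.1.2, u.2)) (tens_assoc X Y Z t) =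
  tens_assoc X Y Z (gact (box (box X Y) Z) u t).
Proof.
elim/tens_ind: t => [|w z t IH]; first by rewrite !linear0.
rewrite !linearD IH box_tens; congr (_ + _).
elim/tens_ind: w => [|x y w IHw]; first by rewrite !linear0 !tens0l !linear0.
by rewrite !(linearD, tensDl) IHw box_tens !tens_assocE tens_mapE box_tens.
Qed.

Lemma eq_tens_map (R : comPzRingType) (X X' Y Y' : lmodType R)
    (f f' : {linear X -> X'}) (g g' : {linear Y -> Y'}) :
  f =1 f' -> g =1 g' -> tens_map f g =1 tens_map f' g'.
Proof.
by move=> eqf eqg; apply: tens_ext => x y; rewrite !tens_mapE eqf eqg.
Qed.

Section Coherence.
Variables (R : comPzRingType) (G : finGroupType) (X Y Z : fg_gmodule R G).
Variables (q : galg R (G * G)%type).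
Implicit Types (t : box (box X Y) Z).

(** The element (g, g, h) acts on (X (x) Y) (x) Z as g does on the G-module
    X (x) Y and h on Z.  This is one edge of the coherence diagram. *)
Lemma Delta_ox_id_act t :
  galg_act (Delta_ox_id q) t =
  galg2_act (X := otimes X Y) (Y := Z) q t.
Proof. exact: galg_act_map. Qed.

Lemma ox_one_act t :
  galg_act (ox_one q) t = tens_map (galg_lin (box X Y) q) idfun t.
Proof.
rewrite galg_act_map; elim/tens_ind: t => [|w z t IH].
  by rewrite linear0 big1 // => u _; rewrite linear0 scaler0.
rewrite linearD -IH tens_mapE.
under eq_bigr do rewrite linearD scalerDr.
rewrite big_split; congr (_ + _).
under eq_bigr do rewrite box_tens gact1 -tensZl.
apply/esym/(big_morph (fun v => tens v z)) => [v v'|].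
- exact: tensDl.
- exact: tens0l.
Qed.

(** The element (g, h, h) acts on X (x) (Y (x) Z) as g on X and h on Y (x) Z, but
    the product G x G x G is associated to the left, as is the tensor product on
    which its group algebra acts; hence the associator. *)
Lemma id_ox_Delta_act t :
  tens_assoc X Y Z (galg_act (id_ox_Delta q) t) =
  galg2_act (X := X) (Y := otimes Y Z) q (tens_assoc X Y Z t).
Proof.
rewrite galg_act_map linear_sum; apply: eq_bigr => u _.
by rewrite linearZ_LR -tens_assoc_gact.
Qed.

Lemma one_ox_act t :
  tens_assoc X Y Z (galg_act (one_ox q) t) =
  tens_map idfun (galg_lin (box Y Z) q) (tens_assoc X Y Z t).
Proof.
rewrite galg_act_map linear_sum.
under eq_bigr do rewrite linearZ_LR -tens_assoc_gact.
move: (tens_assoc X Y Z t) => s; elim/tens_ind: s => [|x w s IH].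
  by rewrite linear0 big1 // => u _; rewrite linear0 scaler0.
rewrite linearD -IH tens_mapE.
under eq_bigr do rewrite linearD scalerDr.
rewrite big_split; congr (_ + _).
under eq_bigr do rewrite tens_mapE gact1 -tensZr.
by apply/esym/(big_morph (tens x)) => [v v'|]; rewrite ?tensDr ?tens0r.
Qed.

End Coherence.

(** Both paths of the diagram become actions on (X (x) Y) (x) Z of products in
    R[G x G x G]; the associativity isomorphism then cancels. *)
Lemma coherent_iff (R : comPzRingType) (G : finGroupType)
    (X Y Z : fg_gmodule R G) (q : galg R (G * G)%type) (t : box (box X Y) Z) :
  galg2_act (X := X) (Y := otimes Y Z) q
    (tens_map idfun (galg_lin (box Y Z) q) (tens_assoc X Y Z t)) =
  tens_assoc X Y Z (galg2_act (X := otimes X Y) (Y := Z) q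
    (tens_map (galg_lin (box X Y) q) idfun t)) <->
  galg_act (id_ox_Delta q * one_ox q) t = galg_act (Delta_ox_id q * ox_one q) t.
Proof.
rewrite -one_ox_act -id_ox_Delta_act -ox_one_act -Delta_ox_id_act !galg_act_mul.
by split=> [/(can_inj (@tens_assocK _ _ _ _))|->].
Qed.

(** * From the three conditions to a quantization *)

Section QuantizationOfElement.
Variables (R : comPzRingType) (G : finGroupType) (q : galg R (G * G)%type).
Hypothesis q_coh : id_ox_Delta q * one_ox q = Delta_ox_id q * ox_one q.
Hypothesis q_norm : forall (X : fg_gmodule R G) (x : X),
  galg2_act q (tens x (unit_elt R G)) = tens x (unit_elt R G) /\
  galg2_act q (tens (unit_elt R G) x) = tens (unit_elt R G) x.
Hypothesis q_nat : forall g : G, q * Delta (gelt R g) = Delta (gelt R g) * q.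

(** The action of g on X (x) Y is that of Delta g, with which q commutes. *)
Lemma galg2_act_equivariant (X Y : fg_gmodule R G) g (t : otimes X Y) :
  galg_lin (box X Y) q (gact (otimes X Y) g t) =
  gact (otimes X Y) g (galg_lin (box X Y) q t).
Proof.
by rewrite -!Delta_elt_act -[LHS]galg_act_mul q_nat galg_act_mul.
Qed.

Definition galg2_hom (X Y : fg_gmodule R G) : gHom (otimes X Y) (otimes X Y) :=
  @GHom R G (otimes X Y) (otimes X Y) (galg_lin (box X Y) q)
    (@galg2_act_equivariant X Y).

Lemma galg2_act_unitr (X : fg_gmodule R G) (t : otimes X (unit_obj R G)) :
  galg2_hom X (unit_obj R G) t = t.
Proof.
elim/tens_ind: t => [|x r t IH]; first exact: linear0.
rewrite linearD IH; congr (_ + _).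
rewrite -[r]mulr1 -[r * 1]/(r *: unit_elt R G) tensZr linearZ.
by congr (_ *: _); have [] := q_norm x.
Qed.

Lemma galg2_act_unitl (X : fg_gmodule R G) (t : otimes (unit_obj R G) X) :
  galg2_hom (unit_obj R G) X t = t.
Proof.
elim/tens_ind: t => [|r x t IH]; first exact: linear0.
rewrite linearD IH; congr (_ + _).
rewrite -[r]mulr1 -[r * 1]/(r *: unit_elt R G) tensZl linearZ.
by congr (_ *: _); have [] := q_norm x.
Qed.

Lemma galg2_act_coherent (X Y Z : fg_gmodule R G)
    (t : otimes (otimes X Y) Z) :
  galg2_hom X (otimes Y Z)
    (tens_map idfun (galg2_hom Y Z) (tens_assoc X Y Z t)) =
  tens_assoc X Y Z
    (galg2_hom (otimes X Y) Z (tens_map (galg2_hom X Y) idfun t)).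
Proof. by apply/(@coherent_iff R G X Y Z); rewrite q_coh. Qed.

Definition quantization_of : quantization R G :=
  @Quantization R G galg2_hom
    (fun X X' Y Y' f g t => @galg2_act_natural R G X X' Y Y' f g q t)
    galg2_act_coherent galg2_act_unitr galg2_act_unitl.

End QuantizationOfElement.

(** * From a quantization to the three conditions *)

Section ElementOfQuantization.
Variables (R : comPzRingType) (G : finGroupType) (q : galg R (G * G)%type).
Variable Q : quantization R G.
Hypothesis Q_tens : forall (X Y : fg_gmodule R G) (x : X) (y : Y),
  Q X Y (tens x y) = galg2_act q (tens x y).

Lemma quant_act (X Y : fg_gmodule R G) : Q X Y =1 galg_lin (box X Y) q.
Proof.
move=> t; elim/tens_ind: t => [|x y t IH]; first by rewrite !linear0.
by rewrite !linearD IH Q_tens.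
Qed.

(** The coherence diagram is evaluated at 1 (x) 1 (x) 1 in the threefold tensor
    power of R[G], where the action determines the element acting. *)
Lemma element_coherent :
  id_ox_Delta q * one_ox q = Delta_ox_id q * ox_one q.
Proof.
apply: galg_eq_by_action (box_regular3_1 R G G G) _.
apply/(@coherent_iff R G (regular_obj R G) (regular_obj R G)
  (regular_obj R G)).
have := @quant_coherent R G Q (regular_obj R G) (regular_obj R G)
  (regular_obj R G) (tens (tens (1 : galg R G) (1 : galg R G)) (1 : galg R G)).
rewrite !quant_act.
rewrite (@eq_tens_map R _ _ _ _ idfun idfun _ _ (fun=> erefl) (@quant_act _ _)).
by rewrite (@eq_tens_map R _ _ _ _ _ _ idfun idfun
  (@quant_act _ _) (fun=> erefl)).
Qed.

(** G-linearity of Q is evaluated at 1 (x) 1 in R[G] (x) R[G]. *)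
Lemma element_natural (g : G) : q * Delta (gelt R g) = Delta (gelt R g) * q.
Proof.
apply: galg_eq_by_action (box_regular1 R G G) _.
pose V := regular_obj R G; rewrite !galg_act_mul.
rewrite (@Delta_elt_act R G V V) (@Delta_elt_act R G V V).
by have := ghom_act (Q V V) g (tens (1 : galg R G) (1 : galg R G));
   rewrite !quant_act.
Qed.

End ElementOfQuantization.

(** * The equivalence *)

Theorem theorem2 (R : comPzRingType) (G : finGroupType)
    (q : galg R (G * G)%type) :
  defines_quantization q <->
  [/\ id_ox_Delta q * one_ox q = Delta_ox_id q * ox_one q,
      (forall (X : fg_gmodule R G) (x : X),
          galg2_act q (tens x (unit_elt R G)) = tens x (unit_elt R G) /\
          galg2_act q (tens (unit_elt R G) x) = tens (unit_elt R G) x)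
    & (forall g : G, q * Delta (gelt R g) = Delta (gelt R g) * q)].
Proof.
split=> [[Q Q_tens]|[q_coh q_norm q_nat]].
  split; last exact: element_natural Q_tens.
  - exact: element_coherent Q_tens.
  - by move=> X x; rewrite -!Q_tens quant_unitr quant_unitl.
by exists (quantization_of q_coh q_norm q_nat).
Qed.
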